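(* Assume that $\widetilde E$ is convex. Then the sequence $\{(\tilde u^{(n)},\lambda^{(n)})\}$ generated by the decoupled augmented Lagrangian method converges to a critical point of the saddle point problem $$\min_{\tilde u\in\widetilde V}\max_{\lambda\in\widetilde V^*}\left\{\widetilde E(\tilde u)+\langle J_{\widetilde V}(I-P_B)\tilde u,\lambda\rangle_{\widetilde V^*}+\frac{\eta}{2}\|(I-P_B)\tilde u\|_2^2\right\}.$$
   Context: Let $\Omega$ be a discrete image domain consisting of $M\times N$ points (pixels) and $V$ the space of all functions $\Omega\to\mathbb R$ with the Euclidean inner product. Let $T:V\to V$ be an operator, and let $\Omega$ be partitioned into $\mathcal N$ disjoint rectangular subdomains $\Omega_1,\dots,\Omega_{\mathcal N}$. For $D\subset\Omega$, the essential domain $\mathrm{ed}_D(T)$ of $T$ on $D$ is the minimal subset $\tilde D\subset\Omega$ such that $T(u)|_D$ can be expressed with the values of $u|_{\tilde D}$ only. Put $\widetilde\Omega_s=\mathrm{ed}_{\Omega_s}(T)$; the sets $\widetilde\Omega_s$ form an overlapping domain decomposition of $\Omega$, with $\Omega_s\subset\widetilde\Omega_s$. Let $\widetilde V_s=\{v\in V:\operatorname{supp}v\subset\widetilde\Omega_s\}$ and $\widetilde V=\bigoplus_{s=1}^{\mathcal N}\widetilde V_s$ (external direct sum, Euclidean inner product). The local energies are $E_s(u)=\sum_{(i,j)\in\Omega_s}T(u)_{ij}$, which depend only on $u|_{\widetilde\Omega_s}$, and $\widetilde E:\widetilde V\to\mathbb R$ is $\widetilde E(\tilde u)=\sum_{s=1}^{\mathcal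 N}E_s(\tilde u_s)$ for $\tilde u=\bigoplus_s\tilde u_s$. The jump operator $B$ maps $\tilde u\in\widetilde V$ to the collection of functions $\tilde u_s|_{\widetilde\Gamma_{st}}-\tilde u_t|_{\widetilde\Gamma_{st}}$, $s<t$, where $\widetilde\Gamma_{st}=\widetilde\Omega_s\cap\widetilde\Omega_t$. $P_B:\widetilde V\to\widetilde V$ is the orthogonal projection onto $\ker B$, and $I$ is the identity. For a finite-dimensional Euclidean space $H$, $J_H:H\to H^*$ is the Riesz isomorphism $(J_Hu)(v)=\langle u,v\rangle_H$, $H^*$ carries the induced inner product and norm, and $J_{H^*}=J_H^{-1}:H^*\to H$ (identifying $H$ with $H^{**}$). $\|\cdot\|_2$ denotes Euclidean norms. Decoupled augmented Lagrangian method: choose $\eta>0$, $\tilde u^{(0)}\in\widetilde V$ and $\lambda^{(0)}\in\widetilde V^*$ with $J_{\widetilde V^*}\lambda^{(0)}\in(\ker B)^\perp$. For $n=0,1,2,\dots$: for each $s=1,\dots,\mathcal N$ set $\hat u_s^{(n+1)}=(P_B\tilde u^{(n)})_s-\frac1\eta J_{\widetilde V_s^*}\lambda_s^{(n)}$ and $$\tilde u_s^{(n+1)}\in\arg\min_{\tilde u_s\in\widetilde V_s}\left\{E_s(\tilde u_s)+\frac\eta2\|\tilde u_s-\hat u_s^{(n+1)}\|_2^2\right\};$$ set $\tilde u^{(n+1)}=\bigoplus_s\tilde u_s^{(n+1)}$ and $\lambda^{(n+1)}=\lambda^{(n)}+\eta J_{\widetilde V}(I-P_B)\tilde u^{(n+1)}$.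 Here $\lambda_s^{(n)}\in\widetilde V_s^*$ is the $s$-th component of $\lambda^{(n)}$. A critical point of the saddle point problem is a pair $(\tilde u^*,\lambda^* )\in\widetilde V\times\widetilde V^*$ with $(I-P_B)\tilde u^*=0$ and $\tilde u^*\in\arg\min_{\tilde u\in\widetilde V}\{\widetilde E(\tilde u)+\langle J_{\widetilde V}(I-P_B)\tilde u,\lambda^*\rangle_{\widetilde V^*}+\frac\eta2\|(I-P_B)\tilde u\|_2^2\}$.
   Formalization: The formal theorem additionally assumes that Ẽ attains its minimum on ker B; without this the claim fails (one subdomain, T the identity: Ẽ is linear, the iterates diverge and no critical point exists), and any critical point forces it. *)

(* Defs.v *)
From HB Require Import structures.
From mathcomp Require Import all_boot all_order all_algebra.
From mathcomp Require Import boolp classical_sets reals topology normedtype.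
From mathcomp Require Import sequences convex.

Set Implicit Arguments.
Unset Strict Implicit.
Unset Printing Implicit Defensive.

Import Order.TTheory GRing.Theory Num.Theory.
Import numFieldNormedType.Exports.

Local Open Scope ring_scope.

HB.mixin Record isEuclid (R : realType) H of Vector R H := {
  dot : H -> H -> R ;
  dotC : forall u v : H, dot u v = dot v u ;
  dotPl : forall (a : R) (u v w : H), dot (a *: u + v) w = a * dot u w + dot v w ;
  dot_gt0 : forall u : H, u != 0 -> 0 < dot u u
}.

#[short(type=euclidType)]
HB.structure Definition Euclid (R : realType) :=
  {H of isEuclid R H & Vector R H}.

Section EuclidTheory.
Variables (R : realType) (H : euclidType R).
Implicit Types (u v w : H) (U : {vspace H}).

Lemma dotPr a u v w : dot w (a *: u + v) = a * dot w u + dot w v.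
Proof. by rewrite dotC dotPl !(dotC _ w). Qed.

Lemma dot0l v : dot (0 : H) v = 0.
Proof. by have := dotPl (-1) v v v; rewrite scaleN1r addNr mulN1r addNr. Qed.

Lemma dotBl u v w : dot (u - v) w = dot u w - dot v w.
Proof. by rewrite addrC -scaleN1r dotPl mulN1r addrC. Qed.

Lemma dot_eq0 u : (dot u u == 0) = (u == 0).
Proof.
apply/idP/eqP => [|->]; last by rewrite dot0l.
by apply: contraTeq => /dot_gt0 /lt0r_neq0.
Qed.

Definition enorm u : R := Num.sqrt (dot u u).

Definition dotr u : H -> R^o := fun v => dot u v.
Fact dotr_linear u : linear (dotr u).
Proof. by move=> a v w; rewrite /dotr dotPr. Qed.
HB.instance Definition _ u :=
  GRing.isLinear.Build R H R^o _ (dotr u) (dotr_linear u).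

Definition riesz_fun u : 'Hom(H, R^o) := linfun (dotr u).

Lemma riesz_funE u v : riesz_fun u v = dot u v.
Proof. by rewrite lfunE. Qed.

Fact riesz_linear : linear riesz_fun.
Proof.
move=> a u v; apply/lfunP => w.
by rewrite add_lfunE scale_lfunE !riesz_funE dotPl.
Qed.
HB.instance Definition _ :=
  GRing.isLinear.Build R H 'Hom(H, R^o) _ riesz_fun riesz_linear.

Definition riesz : 'Hom(H, 'Hom(H, R^o)) := linfun riesz_fun.

Lemma rieszE u v : riesz u v = dot u v.
Proof. by rewrite lfunE riesz_funE. Qed.

Lemma lker_riesz : lker riesz == 0%VS.
Proof.
apply/lker0P => u v /lfunP /(_ (u - v)); rewrite !rieszE => duv.
by apply/eqP; rewrite -subr_eq0 -dot_eq0 dotBl duv subrr.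
Qed.

(** [f^-1] is in general only a right inverse on the image of [f]; see [rieszK]
    and [riesz_invK] for the fact that it is a two-sided inverse here. *)
Definition riesz_inv : 'Hom('Hom(H, R^o), H) := (riesz^-1)%VF.

Lemma rieszK : cancel riesz riesz_inv.
Proof. exact: lker0_lfunK lker_riesz. Qed.

Lemma riesz_invK : cancel riesz_inv riesz.
Proof.
move=> l; apply: limg_lfunVK; suff -> : limg riesz = fullv by rewrite memvf.
apply/eqP; rewrite eqEdim subvf /= limg_dim_eq ?dimvf ?(eqP lker_riesz) ?capv0 //.
by rewrite /dim /= muln1.
Qed.

Lemma riesz_invE (l : 'Hom(H, R^o)) v : dot (riesz_inv l) v = l v.
Proof. by rewrite -rieszE riesz_invK. Qed.

Definition orthv U : {vspace H} := (\bigcap_(v <- vbasis U) lker (riesz v))%VS.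

Lemma memv_orthP U w :
  reflect (forall v, v \in U -> dot v w = 0) (w \in orthv U).
Proof.
have -> : (w \in orthv U) = all (fun v => w \in lker (riesz v)) (vbasis U).
  rewrite /orthv; elim: (tval _) => [|v s IHs] /=.
    by rewrite big_nil memvf.
  by rewrite big_cons memv_cap IHs.
apply: (iffP allP) => [wU v /coord_vbasis -> | wU v /vbasis_mem vU]; last first.
  by rewrite memv_ker rieszE wU.
rewrite dotC -riesz_funE linear_sum /= big1 // => i _; rewrite linearZ /=.
have /wU : (vbasis U)`_i \in vbasis U by rewrite mem_nth // size_tuple.
by rewrite memv_ker rieszE riesz_funE dotC => /eqP ->; rewrite scaler0.
Qed.

Lemma capv_orthv U : (U :&: orthv U = 0)%VS.
Proof.
apply/eqP; rewrite -subv0; apply/subvP => u; rewrite memv_cap.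
by case/andP => uU /memv_orthP/(_ u uU) /eqP; rewrite dot_eq0 memv0.
Qed.

Lemma addv_orthv U : (U + orthv U = fullv)%VS.
Proof.
apply/eqP; rewrite eqEdim subvf /= dimv_disjoint_sum ?capv_orthv //.
pose f : H -> {ffun 'I_(\dim U) -> R^o} :=
  fun w => [ffun i : 'I_(\dim U) => riesz (vbasis U)`_i w].
have f_lin : linear f.
  by move=> a v w; apply/ffunP => i; rewrite !ffunE linearP.
pose fM := GRing.isLinear.Build _ _ _ _ f f_lin.
pose fL : {linear H -> {ffun 'I_(\dim U) -> R^o}} := HB.pack f fM.
have kerf : (lker (linfun fL) <= orthv U)%VS.
  apply/subvP => w; rewrite memv_ker lfunE => /eqP /ffunP fw0.
  apply/memv_orthP => v /coord_vbasis ->; rewrite dotC -riesz_funE linear_sum.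
  rewrite big1 // => i _; rewrite linearZ /= riesz_funE dotC -rieszE.
  by have := fw0 i; rewrite !ffunE => ->; rewrite scaler0.
rewrite -(limg_ker_dim (linfun fL) fullv) capfv addnC leq_add ?dimvS //.
by rewrite (leq_trans (dimvS (subvf _))) // dimvf /dim /= card_ord muln1.
Qed.

Definition orth_proj U : 'End(H) := daddv_pi U (orthv U).

Lemma orth_projP U u :
  orth_proj U u \in U /\ u - orth_proj U u \in orthv U.
Proof.
split; first exact: memv_pi.
have uUo : u \in (U + orthv U)%VS by rewrite addv_orthv memvf.
rewrite -[X in X - _](daddv_pi_add (capv_orthv U) uUo) addrC addKr.
exact: memv_pi.
Qed.

End EuclidTheory.

Section Instances.
Variable R : realType.

Definition rdot (u v : R^o) : R := u * v.
Fact rdotC u v : rdot u v = rdot v u. Proof. exact: mulrC. Qed.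
Fact rdotPl (a : R) u v w : rdot (a *: u + v) w = a * rdot u w + rdot v w.
Proof. by rewrite /rdot mulrDl -mulrA. Qed.
Fact rdot_gt0 u : u != 0 -> 0 < rdot u u.
Proof. by move=> u0; rewrite /rdot -expr2 exprn_even_gt0. Qed.
HB.instance Definition _ := isEuclid.Build R R^o rdotC rdotPl rdot_gt0.

Section Ffun.
Variables (I : finType) (H : euclidType R).
Definition fdot (u v : {ffun I -> H}) : R := \sum_i dot (u i) (v i).
Fact fdotC u v : fdot u v = fdot v u.
Proof. by apply: eq_bigr => i _; rewrite dotC. Qed.
Fact fdotPl a u v w : fdot (a *: u + v) w = a * fdot u w + fdot v w.
Proof.
by rewrite /fdot mulr_sumr -big_split; apply: eq_bigr => i _; rewrite !ffunE dotPl.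
Qed.
Fact fdot_gt0 u : u != 0 -> 0 < fdot u u.
Proof.
have dge0 (x : H) : 0 <= dot x x.
  by have [->|/dot_gt0/ltW//] := eqVneq x 0; rewrite dot0l.
move=> u0; rewrite lt_def sumr_ge0 // andbT.
apply: contra_neq u0 => /psumr_eq0P u0; apply/ffunP => i; rewrite ffunE.
by apply/eqP; rewrite -dot_eq0 u0.
Qed.
HB.instance Definition _ :=
  isEuclid.Build R {ffun I -> H} fdotC fdotPl fdot_gt0.
End Ffun.

Section Subspace.
Variables (H : euclidType R) (U : {vspace H}).
Definition sdot (u v : subvs_of U) : R := dot (vsval u) (vsval v).
Fact sdotC u v : sdot u v = sdot v u. Proof. exact: dotC. Qed.
Fact sdotPl a u v w : sdot (a *: u + v) w = a * sdot u w + sdot v w.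
Proof. by rewrite /sdot -dotPl linearP. Qed.
Fact sdot_gt0 u : u != 0 -> 0 < sdot u u.
Proof. by move=> u0; apply: dot_gt0; rewrite -(inj_eq val_inj) in u0. Qed.
HB.instance Definition _ :=
  isEuclid.Build R (subvs_of U) sdotC sdotPl sdot_gt0.
End Subspace.

Section Dual.
Variable H : euclidType R.
Definition ddot (p q : 'Hom(H, R^o)) : R := dot (riesz_inv H p) (riesz_inv H q).
Fact ddotC p q : ddot p q = ddot q p. Proof. exact: dotC. Qed.
Fact ddotPl a p q r : ddot (a *: p + q) r = a * ddot p r + ddot q r.
Proof. by rewrite /ddot linearP dotPl. Qed.
Fact ddot_gt0 p : p != 0 -> 0 < ddot p p.
Proof.
move=> p0; apply: dot_gt0; apply: contra_neq p0 => p0.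
by rewrite -[p]riesz_invK p0 linear0.
Qed.
HB.instance Definition _ :=
  isEuclid.Build R 'Hom(H, R^o) ddotC ddotPl ddot_gt0.
End Dual.

End Instances.

Section DirectSum.
Variables (R : realType) (I : finType) (H : euclidType R).
Variable U : I -> {vspace H}.

Definition fam_proj i : {ffun I -> H} -> H := fun u => u i.
Fact proj_linear i : linear (fam_proj i).
Proof. by move=> a u v; rewrite /fam_proj !ffunE. Qed.
HB.instance Definition _ i :=
  GRing.isLinear.Build R {ffun I -> H} H _ (fam_proj i) (proj_linear i).

Definition dsumv : {vspace {ffun I -> H}} :=
  (\bigcap_i (linfun (fam_proj i) @^-1: U i))%VS.

Lemma mem_dsumvP (u : {ffun I -> H}) :
  reflect (forall i, u i \in U i) (u \in dsumv).
Proof.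
rewrite memvE /dsumv; apply: (iffP subv_bigcapP) => uU i.
  by have := uU i isT; rewrite -memvE -memv_preim lfunE.
by move=> _; rewrite -memvE -memv_preim lfunE; apply: uU.
Qed.

Definition dsum := subvs_of dsumv.
HB.instance Definition _ := Euclid.on dsum.

Definition dsum_comp i (u : dsum) : subvs_of (U i) := vsproj (U i) (vsval u i).

Lemma dsum_compE i u : vsval (dsum_comp i u) = vsval u i.
Proof. by rewrite vsprojK //; apply/mem_dsumvP/valP. Qed.

Definition fam_inj i : subvs_of (U i) -> dsum := fun w =>
  vsproj dsumv [ffun j => if j == i then vsval w else 0].

Fact injE i w j : vsval (@fam_inj i w) j = if j == i then vsval w else 0.
Proof.
rewrite vsprojK ?ffunE //; apply/mem_dsumvP => k; rewrite ffunE.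
by case: eqP => [->|_]; [apply: valP|apply: mem0v].
Qed.

Fact inj_linear i : linear (@fam_inj i).
Proof.
move=> a v w; apply/val_inj/ffunP => j; rewrite injE linearP !ffunE !injE.
by case: eqP => _; rewrite ?linearP // scaler0 addr0.
Qed.
HB.instance Definition _ i :=
  GRing.isLinear.Build R (subvs_of (U i)) dsum _ (@fam_inj i) (@inj_linear i).

Definition dsum_inj i : 'Hom(subvs_of (U i), dsum) := linfun (@fam_inj i).

Lemma dsum_injE i w j :
  vsval (dsum_inj i w) j = if j == i then vsval w else 0.
Proof. by rewrite lfunE injE. Qed.

(** The dual of the direct sum is the direct sum of the duals: the component of
    a linear form is its restriction to the corresponding summand. *)
Definition dual_comp (l : 'Hom(dsum, R^o)) i : 'Hom(subvs_of (U i), R^o) :=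
  (l \o dsum_inj i)%VF.

End DirectSum.

Definition pixel (M N : nat) : finType := ('I_M * 'I_N)%type.

Definition rectangle (M N : nat) (D : {set pixel M N}) : Prop :=
  exists i0 i1 j0 j1 : nat,
    D = [set x : pixel M N | (i0 <= x.1 < i1)%N && (j0 <= x.2 < j1)%N]%SET.

Definition rectangular_partition (M N K : nat) (Om : 'I_K -> {set pixel M N}) :
    Prop :=
  [/\ forall s, Om s != finset.set0 /\ rectangle (Om s),
      forall s t, s != t -> [disjoint Om s & Om t]
    & forall x, exists s, x \in Om s].

Section EssentialDomain.
Variables (R : realType) (X : finType).

Definition imageV := {ffun X -> R^o}.
HB.instance Definition _ := Euclid.on imageV.

Variables (T : imageV -> imageV) (D : {set X}).

Definition determines (A : {set X}) : Prop :=
  forall u v : imageV, {in A, u =1 v} -> {in D, T u =1 T v}.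

(** Determining sets are closed under intersection, so the intersection of all
    of them is the unique minimal one; see [ed_minset]. *)
Definition ed : {set X} :=
  (\bigcap_(A : {set X} | `[< determines A >]) A)%SET.

Lemma determinesT : determines [set: X]%SET.
Proof. by move=> u v uv; rewrite (_ : u = v) //; apply/ffunP => x; rewrite uv ?inE. Qed.

Lemma determinesI A B :
  determines A -> determines B -> determines (A :&: B)%SET.
Proof.
move=> dA dB u v uv x xD.
pose w : imageV := [ffun y => if y \in A then u y else v y].
have -> : T u x = T w x by apply: dA => // y yA; rewrite ffunE yA.
apply: dB => // y yB; rewrite ffunE; case: ifP => // yA.
by apply: uv; rewrite inE yA.
Qed.

Lemma determines_ed : determines ed.
Proof.
rewrite /ed; elim/big_ind: _ => [||A /asboolP//].
  exact: determinesT.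
exact: determinesI.
Qed.

Lemma ed_minset : minset (fun A => `[< determines A >]) ed.
Proof.
apply/minsetP; split=> [|B dB sB]; first exact/asboolP/determines_ed.
by apply/eqP; rewrite finset.eqEsubset sB finset.bigcap_inf.
Qed.

End EssentialDomain.

Section Support.
Variables (R : realType) (X : finType) (A : {set X}).

Definition pixel_eval x : imageV R X -> R^o := fun u => u x.
Fact pixel_eval_linear x : linear (pixel_eval x).
Proof. by move=> a u v; rewrite /pixel_eval !ffunE. Qed.
HB.instance Definition _ x :=
  GRing.isLinear.Build R (imageV R X) R^o _ (pixel_eval x) (pixel_eval_linear x).

Definition suppv : {vspace imageV R X} :=
  (\bigcap_(x | x \notin A) lker (linfun (pixel_eval x)))%VS.

Lemma mem_suppvP (u : imageV R X) :
  reflect (forall x, x \notin A -> u x = 0) (u \in suppv).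
Proof.
rewrite memvE /suppv; apply: (iffP subv_bigcapP) => uA x xA.
  by have := uA x xA; rewrite -memvE memv_ker lfunE => /eqP.
by rewrite -memvE memv_ker lfunE /= /pixel_eval uA.
Qed.

End Support.

Definition argmin (R : realType) (X : Type) (f : X -> R) : set X :=
  [set x | forall y, f x <= f y]%classic.

Section Method.
Variables (R : realType) (M N K : nat).
Variable T : imageV R (pixel M N) -> imageV R (pixel M N).
Variable Om : 'I_K -> {set pixel M N}.

Definition tOm s : {set pixel M N} := ed T (Om s).
Definition tV s := subvs_of (suppv R (tOm s)).
HB.instance Definition _ s := Euclid.on (tV s).
Definition tVsum := dsum (fun s => suppv R (tOm s)).
HB.instance Definition _ := Euclid.on tVsum.

Lemma tVsum_compE s (u : tVsum) : vsval (dsum_comp s u) = vsval u s.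
Proof. exact: dsum_compE. Qed.

Definition localE s (u : imageV R (pixel M N)) : R := \sum_(x in Om s) T u x.

Definition tE (u : tVsum) : R := \sum_s localE s (vsval (dsum_comp s u)).

(** A family of functions on the interfaces of [s] and [t], for [s < t], is
    encoded as one function on the disjoint union of these interfaces. *)
Definition jump_index := {k : 'I_K * 'I_K * pixel M N |
  (k.1.1 < k.1.2)%N && (k.2 \in tOm k.1.1 :&: tOm k.1.2)%SET}.
HB.instance Definition _ := Finite.on jump_index.

Definition jump_fun (u : tVsum) : {ffun jump_index -> R^o} :=
  [ffun k => let: (s, t, x) := val k in
    vsval (dsum_comp s u) x - vsval (dsum_comp t u) x].
Fact jump_linear : linear jump_fun.
Proof.
move=> a u v; apply/ffunP => k; rewrite !ffunE; case: (val k) => [[s t] x] /=.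
rewrite !tVsum_compE linearP /= !ffunE /= scalerBr.
by rewrite opprD addrACA.
Qed.
HB.instance Definition _ :=
  GRing.isLinear.Build R tVsum {ffun jump_index -> R^o} _ jump_fun jump_linear.

Definition jump : 'Hom(tVsum, {ffun jump_index -> R^o}) := linfun jump_fun.

Definition PB : 'End(tVsum) := orth_proj (lker jump).

Definition PBc : 'End(tVsum) := (\1 - PB)%VF.

Variable eta : R.

Definition hatu (u : tVsum) (l : 'Hom(tVsum, R^o)) s : tV s :=
  dsum_comp s (PB u) - eta^-1 *: riesz_inv _ (dual_comp l s).

(** A relation and not a recursive definition, as [argmin] may be any set; an
    element of [tVsum] is determined by its components. *)
Definition dalm (u : nat -> tVsum) (l : nat -> 'Hom(tVsum, R^o)) : Prop :=
  riesz_inv _ (l 0%N) \in orthv (lker jump) /\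
  forall n,
    (forall s, argmin
       (fun w : tV s => localE s (vsval w)
          + eta / 2 * enorm (w - hatu (u n) (l n) s) ^+ 2)
       (dsum_comp s (u n.+1))) /\
    l n.+1 = l n + eta *: riesz _ (PBc (u n.+1)).

Definition lagrangian (u : tVsum) (l : 'Hom(tVsum, R^o)) : R :=
  tE u + dot (riesz _ (PBc u)) l + eta / 2 * enorm (PBc u) ^+ 2.

Definition critical_point (u : tVsum) (l : 'Hom(tVsum, R^o)) : Prop :=
  PBc u = 0 /\ argmin (fun v => lagrangian v l) u.

End Method.

(* Main.v *)
Require Import Defs.
From mathcomp Require Import all_boot all_order all_algebra.
From mathcomp Require Import boolp classical_sets reals topology normedtype.
From mathcomp Require Import sequences convex.
From mathcomp Require Import interval_inference realfun ring lra.

(** Write W for the kernel of the jump operator, P for the orthogonal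
    projection onto W, Q for I - P, f for the total energy and m_n for the Riesz
    representative of lambda_n, which stays in the orthogonal complement of W.
    As the squared distance in a direct sum is the sum of the squared distances
    of the components, the local minimizations together say that u_(n+1) is the
    proximal point of f, with parameter eta, at z_n := P u_n - m_n / eta
    ([prox_of_local_argmin]); equivalently eta (z_n - u_(n+1)) is a subgradient
    of f at u_(n+1) ([prox_subgrad]). Now z_n determines both P u_n and m_n, and
      z_(n+1) = P u_(n+1) + Q (z_n - u_(n+1)),
    which is the partial inverse method of Spingarn. So the whole iteration is a
    fixed point iteration for one point z_n of the Euclidean space.

    A fixed point p is characterized by: eta Q p is a subgradient of f at P p.
    Such a p gives the critical point (P p, - eta Q p) ([critical_of_fixpoint]).
    Conversely a minimizer of f on W, together with a subgradient of f at it
    that is orthogonal to W (a Lagrange multiplier, [constrained_min_subgrad]),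
    gives a fixed point, so that fixed points exist. Subgradients come from a
    sandwich theorem of Hahn-Banach type, proved by adding one dimension at a
    time ([extension_slope], [convex_orth_minorant]).

    Monotonicity of the subgradient makes the iteration firmly nonexpansive
    ([fejer]): with respect to any fixed point p,
      |z_(n+1) - p|^2 + |z_(n+1) - z_n|^2 <= |z_n - p|^2.
    Hence z_n is bounded and z_(n+1) - z_n tends to 0. By compactness z_n
    converges along an ultrafilter to some p; passing to the limit in the
    subgradient inequality, where the lower semicontinuity of f follows from the
    existence of a subgradient at P p, shows that p is a fixed point. Then
    |z_n - p| is nonincreasing and tends to 0 along the ultrafilter, hence tends
    to 0, and u_n and m_n follow since both are continuous images of the z_n
    ([partial_inverse_cvg]). *)

Set Implicit Arguments.
Unset Strict Implicit.
Unset Printing Implicit Defensive.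

Import Order.TTheory GRing.Theory Num.Theory.
Import numFieldNormedType.Exports.

Local Open Scope classical_set_scope.
Local Open Scope ring_scope.

(** * Inner products and orthogonal projections *)

Section Dot.
Variables (R : realType) (H : euclidType R).
Implicit Types (u v w : H) (a : R).

Lemma dotDl u v w : dot (u + v) w = dot u w + dot v w.
Proof. by rewrite -[u]scale1r dotPl mul1r scale1r. Qed.

Lemma dotZl a u v : dot (a *: u) v = a * dot u v.
Proof. by rewrite -[a *: u]addr0 dotPl dot0l addr0. Qed.

Lemma dotNl u v : dot (- u) v = - dot u v.
Proof. by rewrite -scaleN1r dotZl mulN1r. Qed.

Lemma dotDr u v w : dot u (v + w) = dot u v + dot u w.
Proof. by rewrite dotC dotDl !(dotC u). Qed.

Lemma dotZr a u v : dot u (a *: v) = a * dot u v.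
Proof. by rewrite dotC dotZl dotC. Qed.

Lemma dotNr u v : dot u (- v) = - dot u v.
Proof. by rewrite dotC dotNl dotC. Qed.

Lemma dot0r u : dot u 0 = 0.
Proof. by rewrite dotC dot0l. Qed.

Definition dot_linE := (dotDl, dotDr, dotNl, dotNr, dotZl, dotZr, dot0l, dot0r).

Lemma dot_ge0 u : 0 <= dot u u.
Proof. by have [->|/dot_gt0/ltW//] := eqVneq u 0; rewrite dot0l. Qed.

Lemma enorm_sqr u : enorm u ^+ 2 = dot u u.
Proof. by rewrite /enorm sqr_sqrtr // dot_ge0. Qed.

Lemma cauchy_schwarz u v : dot u v ^+ 2 <= dot u u * dot v v.
Proof.
have [->|v0] := eqVneq v 0; first by rewrite !dot0r expr0n mulr0.
have vv := dot_gt0 _ v0.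
have := dot_ge0 (dot v v *: u - dot u v *: v).
rewrite !dot_linE (dotC v u).
set a := dot u u; set b := dot u v; set c := dot v v in vv *.
rewrite [X in 0 <= X](_ : _ = c * (a * c - b ^+ 2)); last by ring.
by rewrite pmulr_rge0 // subr_ge0.
Qed.

(** Reduces an equation between vectors to one between scalars, which after
    expansion by [dot_linE] is within reach of [ring]. *)
Lemma dot_inj u v : (forall w, dot u w = dot v w) -> u = v.
Proof.
by move=> uv; apply/eqP; rewrite -subr_eq0 -dot_eq0 dotBl uv subrr.
Qed.

Lemma dot_sumr (I : finType) (c : I -> R) (b : I -> H) w :
  dot w (\sum_i c i *: b i) = \sum_i c i * dot w (b i).
Proof.
rewrite -riesz_funE linear_sum; apply: eq_bigr => i _.
by rewrite linearZ /= riesz_funE.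
Qed.

Lemma orthvP (U : {vspace H}) u v : u \in U -> v \in orthv U -> dot u v = 0.
Proof. by move=> uU /memv_orthP; apply. Qed.

Lemma orthvS (U W : {vspace H}) : (U <= W)%VS -> (orthv W <= orthv U)%VS.
Proof.
move=> /subvP UW; apply/subvP => y /memv_orthP yW.
by apply/memv_orthP => v /UW; apply: yW.
Qed.

Lemma orth_proj_id (U : {vspace H}) u : u \in U -> orth_proj U u = u.
Proof.
move=> uU; have [pU qU] := orth_projP U u.
apply/esym/eqP; rewrite -subr_eq0 -memv0 -(capv_orthv U) memv_cap qU andbT.
exact: memvB.
Qed.

Lemma orth_proj_idem (U : {vspace H}) u :
  orth_proj U (orth_proj U u) = orth_proj U u.
Proof. by apply: orth_proj_id; case: (orth_projP U u). Qed.

Lemma orth_proj_orth (U : {vspace H}) u : u \in orthv U -> orth_proj U u = 0.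
Proof.
move=> uU; have [pU qU] := orth_projP U u.
apply/eqP; rewrite -memv0 -(capv_orthv U) memv_cap pU /=.
by rewrite -[X in X \in _](subKr u) memvB.
Qed.

Lemma dot_projl (U : {vspace H}) u v :
  dot (orth_proj U u) v = dot (orth_proj U u) (orth_proj U v).
Proof.
have [pU _] := orth_projP U u; have [_ qU] := orth_projP U v.
by apply/eqP; rewrite -subr_eq0 -dotNr -dotDr (orthvP pU qU).
Qed.

Lemma dot_proj (U : {vspace H}) u v :
  dot (orth_proj U u) v = dot u (orth_proj U v).
Proof. by rewrite dot_projl dotC -dot_projl dotC. Qed.

(** The expansion v = sum_i <a_i, v> b_i, in which the a_i represent the
    coordinate forms; the basis b_i need not be orthonormal. *)
Lemma dual_basis : exists a b : 'I_(\dim {:H}) -> H,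
  forall v, v = \sum_i dot (a i) v *: b i.
Proof.
pose c i : 'Hom(H, R^o) := linfun (coord (vbasis {:H}) i).
exists (fun i => riesz_inv H (c i)), (fun i => (vbasis {:H})`_i) => v.
rewrite {1}(coord_vbasis (memvf v)); apply: eq_bigr => i _.
by rewrite riesz_invE lfunE.
Qed.

End Dot.

Lemma le0_of_small (R : realType) (d c : R) :
  (forall t, 0 < t <= 1 -> d <= t * c) -> d <= 0.
Proof.
move=> key; rewrite leNgt; apply/negP => d0.
have := key 1; rewrite ltr01 lexx mul1r => /(_ isT) dc.
have c0 : 0 < c by apply: lt_le_trans dc.
(* At t = d / (2 c) the bound reads d <= d / 2. *)
have tc : 0 < d / (c + c) <= 1.
  rewrite divr_gt0 ?addr_gt0 //=.
  by rewrite ler_pdivrMr ?addr_gt0 // mul1r (le_trans dc) // lerDl ltW.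
have := key _ tc.
have -> : d / (c + c) * c = d / 2 by field; rewrite gt_eqF ?addr_gt0.
by lra.
Qed.

(** * Subgradients of convex functions *)

Section Subgradient.
Variables (R : realType) (H : euclidType R).
Implicit Types (f g : H -> R) (u v w x y : H) (W : {vspace H}).

(** The library notion of convexity, with a plain real weight in place of an
    element of the unit interval type. *)
Definition convexf f := forall (t : R) x y, 0 <= t <= 1 ->
  f (t *: x + (1 - t) *: y) <= t * f x + (1 - t) * f y.

Lemma convex_function_convexf f :
  convex_function [set: convex_lmodType H] f -> convexf f.
Proof.
by move=> cf t x y /andP[t0 t1]; apply: (cf (Itv01 t0 t1)); rewrite inE.
Qed.

Definition subgrad f u y := forall v, f u + dot y (v - u) <= f v.

Lemma convexf_sub_dot g y : convexf g -> convexf (fun v => g v - dot y v).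
Proof.
move=> cg t u v /(cg t u v) gt; rewrite !dot_linE.
by apply: le_trans (lerB gt (lexx _)) _; lra.
Qed.

(** Hahn-Banach extension by one dimension: the zero form on W, which is below
    g there, extends to W + <x> with slope a along x and stays below g. The
    slopes forced from below by the points w - s x and those forced from above
    by the points w + t x are separated because the convex combination of two
    such points that cancels x lies in W, where g is nonnegative. *)
Lemma extension_slope g W x : convexf g -> {in W, forall w, 0 <= g w} ->
  exists a : R, {in W, forall w, forall t : R, t * a <= g (w + t *: x)}.
Proof.
move=> cg gW.
pose S : set R := [set r : R | exists w, exists s : R,
  [/\ w \in W, 0 < s & r = - g (w - s *: x) / s]].
have S0 : S !=set0 by exists (- g (0 - 1 *: x) / 1), 0, 1; rewrite mem0v.
have key w1 w (s t : R) : w1 \in W -> w \in W -> 0 < s -> 0 < t ->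
    - g (w1 - s *: x) / s <= g (w + t *: x) / t.
  move=> w1W wW s0 t0.
  have st0 : 0 < s + t by rewrite addr_gt0.
  rewrite ler_pdivrMr // mulrAC ler_pdivlMr // mulNr -subr_ge0 opprK.
  (* The weights for which x cancels. *)
  pose r := t / (s + t).
  have r01 : 0 <= r <= 1.
    by rewrite /r ler_pdivrMr // mul1r lerDr (ltW s0) divr_ge0 // ltW.
  have r1 : 1 - r = s / (s + t) by rewrite /r; field; rewrite gt_eqF.
  have := le_trans _ (cg r (w1 - s *: x) (w + t *: x) r01).
  have -> : r *: (w1 - s *: x) + (1 - r) *: (w + t *: x) =
            r *: w1 + (1 - r) *: w.
    have rst : (1 - r) * t = r * s.
      by rewrite r1 /r mulrAC [RHS]mulrAC (mulrC s).
    by rewrite !scalerDr scalerN !scalerA rst addrACA addNr addr0.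
  move=> /(_ 0); rewrite gW ?memvD ?memvZ // => /(_ isT).
  rewrite r1 /r; move: (g _) (g _) => p q.
  rewrite (_ : _ + _ = (s + t)^-1 * (p * s + q * t)); last by ring.
  by rewrite pmulr_rge0 ?invr_gt0.
have Sub w (t : R) : w \in W -> 0 < t -> ubound S (g (w + t *: x) / t).
  by move=> wW t0 _ [w1 [s [w1W s0 ->]]]; apply: key.
exists (sup S) => w wW t; have [t0|t0|->] := ltgtP t 0.
- have : - g (w + t *: x) / - t <= sup S.
    apply: sup_upper_bound.
      split=> //; exists (g (0 + 1 *: x) / 1); apply: Sub => //.
      by rewrite mem0v.
    by exists w, (- t); rewrite scaleNr opprK oppr_gt0.
  by rewrite ler_pdivrMr ?oppr_gt0 // mulrN lerN2 mulrC.
- by rewrite mulrC -ler_pdivlMr //; apply: ge_sup => //; apply: Sub.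
- by rewrite mul0r scale0r addr0 gW.
Qed.

(** The sandwich theorem between the zero form on W and g. The induction on the
    codimension of W adds a vector x orthogonal to W, subtracts from g the form
    along x given by [extension_slope], and continues with W + <x>. *)
Lemma convex_orth_minorant g W : convexf g -> {in W, forall w, 0 <= g w} ->
  exists2 y, y \in orthv W & forall v, dot y v <= g v.
Proof.
have [n] := ubnP (\dim {:H} - \dim W).
elim: n => // n IHn in g W *; rewrite ltnS => leWn cg gW.
have [WH|WH] := eqVneq W fullv.
  by exists 0 => [|v]; rewrite ?mem0v // dot0l gW // WH memvf.
have oW0 : orthv W != 0%VS.
  by apply: contra_neq WH => oW0; rewrite -(addv_orthv W) oW0 addv0.
set x := vpick (orthv W).
have x0 : x != 0 by rewrite vpick0.
have xW : x \in orthv W by apply: memv_pick.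
have [a ga] := extension_slope x cg gW.
pose W1 := (W + <[x]>)%VS; pose y1 := (a / dot x x) *: x.
have WW1 : (W <= W1)%VS by apply: addvSl.
have xxN0 : dot x x != 0 by rewrite dot_eq0.
have [||w /memv_addP[w0 w0W [_ /vlineP[t ->] ->]]|y2 y2W y2g] :=
  IHn (fun v => g v - dot y1 v) W1.
- apply: leq_trans leWn; rewrite ltn_sub2l //.
    rewrite ltn_neqAle dimvS ?subvf // andbT.
    by apply: contraNneq WH => dW; rewrite eqEdim subvf dW leqnn.
  rewrite ltn_neqAle dimvS // andbT; apply: contraNneq x0 => dW.
  have /eqP WE : W == W1 by rewrite eqEdim WW1 dW leqnn.
  have xW' : x \in W by rewrite WE (subvP (addvSr W _)) // memv_line.
  by rewrite -dot_eq0 (orthvP xW' xW).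
- exact: convexf_sub_dot.
- rewrite subr_ge0; apply: le_trans (ga _ w0W t).
  by rewrite !dot_linE (dotC x w0) (orthvP w0W xW) mulr0 add0r mulrCA divfK.
exists (y1 + y2) => [|v]; last by rewrite dotDl addrC -lerBrDr.
by rewrite memvD ?memvZ // (subvP (orthvS WW1)).
Qed.

(** The vector y is the Lagrange multiplier of the constraint W; it comes from
    [convex_orth_minorant] applied to f - f u0, which is nonnegative on W. *)
Lemma constrained_min_subgrad f W u0 : convexf f -> u0 \in W ->
  {in W, forall v, f u0 <= f v} -> exists2 y, y \in orthv W & subgrad f u0 y.
Proof.
move=> cf u0W fmin.
have [|w wW|y yW yf] := @convex_orth_minorant (fun v => f v - f u0) W.
- by move=> t x y /(cf t x y); lra.
- by rewrite subr_ge0 fmin.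
exists y => // v; rewrite dotDr dotNr (dotC y u0) (orthvP u0W yW) subr0.
by rewrite addrC -lerBrDr.
Qed.

Lemma subgrad_exists f u : convexf f -> exists y, subgrad f u y.
Proof.
move=> cf.
have [|w|y _ yf] := @convex_orth_minorant (fun v => f (v + u) - f u) 0%VS.
- move=> t x y /(cf t (x + u) (y + u)).
  have -> : t *: (x + u) + (1 - t) *: (y + u) = t *: x + (1 - t) *: y + u.
    by rewrite !scalerDr addrACA -scalerDl [t + _]addrC subrK scale1r.
  by lra.
- by rewrite memv0 => /eqP ->; rewrite add0r subrr.
by exists y => v; have := yf (v - u); rewrite subrK lerBrDr addrC.
Qed.

(** First order optimality. Comparing u with the points u + t (v - u) of the
    segment to v gives the subgradient inequality at v up to a term linear in t,
    and t is arbitrarily small. *)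
Lemma prox_subgrad f eta z u : convexf f ->
  (forall v, f u + eta / 2 * dot (u - z) (u - z) <=
             f v + eta / 2 * dot (v - z) (v - z)) ->
  subgrad f u (eta *: (z - u)).
Proof.
move=> cf umin v; set c := eta / 2 * dot (v - u) (v - u).
suff key t : 0 < t <= 1 -> f u + eta * dot (z - u) (v - u) - f v <= t * c.
  by rewrite dotZl -subr_le0; apply: le0_of_small key.
case/andP=> t0 t1; rewrite -(ler_pM2l t0).
have := le_trans (umin (t *: v + (1 - t) *: u)) (lerD (cf t v u _) (lexx _)).
rewrite t1 ltW // => /(_ isT).
have -> : t *: v + (1 - t) *: u - z = t *: (v - u) + (u - z).
  by rewrite scalerBl scale1r scalerBr -!addrA; congr (_ + _); rewrite addrCA.
rewrite -(opprB u z) /c; move: (v - u) (u - z) => p q.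
rewrite !dot_linE (dotC q p); lra.
Qed.

End Subgradient.

(** * Convergence in a Euclidean space *)

Section Cvg.
Variables (R : realType) (H : euclidType R).
Variable I : Type.
Implicit Types (u v w p q : H) (y z : I -> H).

(** Weak convergence, which in finite dimension is convergence in norm (see
    [wcvg_enorm] and [wcvg_dot0]). It turns limits of vectors into limits of
    real numbers, without a topology on the Euclidean space. *)
Definition wcvg (F : set_system I) z p :=
  forall w, dot w (z n) @[n --> F] --> dot w p.

Section AnyFilter.
Context {F : set_system I} {FF : Filter F}.

Lemma wcvg_cst p : wcvg F (fun=> p) p.
Proof. by move=> w; apply: cvg_cst. Qed.

Lemma wcvgD y z p q : wcvg F y p -> wcvg F z q ->
  wcvg F (fun n => y n + z n) (p + q).
Proof.
move=> yp zq w; rewrite dotDr; under eq_fun do rewrite dotDr.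
exact: cvgD (yp w) (zq w).
Qed.

Lemma wcvgN z p : wcvg F z p -> wcvg F (fun n => - z n) (- p).
Proof.
move=> zp w; rewrite dotNr; under eq_fun do rewrite dotNr.
exact: cvgN (zp w).
Qed.

Lemma wcvgB y z p q : wcvg F y p -> wcvg F z q ->
  wcvg F (fun n => y n - z n) (p - q).
Proof. by move=> yp /wcvgN; apply: wcvgD. Qed.

Lemma wcvgZ (c : R) z p : wcvg F z p -> wcvg F (fun n => c *: z n) (c *: p).
Proof.
move=> zp w; rewrite dotZr.
have -> : (fun n => dot w (c *: z n)) = fun n => c * dot w (z n).
  by apply/funext => n; rewrite dotZr.
by apply: cvgM; [apply: cvg_cst | apply: zp].
Qed.

Lemma wcvg_proj U z p : wcvg F z p ->
  wcvg F (fun n => orth_proj U (z n)) (orth_proj U p).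
Proof.
move=> zp w; rewrite -dot_proj; under eq_fun do rewrite -dot_proj.
exact: zp.
Qed.

(** The inner product of two weakly convergent families converges because it
    is a finite sum of products of coordinates. *)
Lemma wcvg_dot y z p q : wcvg F y p -> wcvg F z q ->
  dot (y n) (z n) @[n --> F] --> dot p q.
Proof.
move=> yp zq; have [a [b ab]] := dual_basis H.
have dotE u v : dot u v = \sum_i dot (a i) u * dot (b i) v.
  rewrite {1}(ab u) dotC dot_sumr.
  by apply: eq_bigr => i _; rewrite (dotC v).
rewrite dotE; under eq_fun do rewrite dotE.
apply: cvg_big => [|i _]; first exact: add_continuous.
by apply: cvgM; [apply: yp | apply: zq].
Qed.

Lemma wcvg_enorm z p : wcvg F z p -> enorm (z n - p) @[n --> F] --> (0 : R).
Proof.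
move=> zp; rewrite -[X in _ --> X](sqrtr0 R) -(dot0l (0 : H)) -(subrr p).
apply: continuous_cvg; first exact: sqrt_continuous.
by apply: wcvg_dot; apply: wcvgB => //; apply: wcvg_cst.
Qed.

Lemma wcvg_dot0 z p : dot (z n - p) (z n - p) @[n --> F] --> (0 : R) ->
  wcvg F z p.
Proof.
move=> zp w; apply/subr_cvg0/norm_cvg0P.
under eq_fun do rewrite -dotNr -dotDr.
have e0 : Num.sqrt (dot w w * dot (z n - p) (z n - p)) @[n --> F] --> (0 : R).
  rewrite -[X in _ --> X](sqrtr0 R) -[X in Num.sqrt X](mulr0 (dot w w)).
  apply: continuous_cvg; first exact: sqrt_continuous.
  exact: cvgM (cvg_cst _) zp.
apply: squeeze_cvgr (cvg_cst 0) e0; near=> n.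
by rewrite normr_ge0 -sqrtr_sqr ler_wsqrtr // cauchy_schwarz.
Unshelve. all: by end_near. Qed.

End AnyFilter.

Lemma ultra_cvg_bounded (U : set_system I) (x : I -> R) M :
  UltraFilter U -> (forall n, `|x n| <= M) -> cvg (x n @[n --> U]).
Proof.
move=> UU xM.
have [|l [_ lx]] := @segment_compact R (- M) M (x n @[n --> U]) _ _.
  apply: (@filterE _ U) => n /=; rewrite in_itv /= -ler_norml; exact: xM.
apply/cvg_ex; exists l => B Bl.
have [//|nB] := in_ultra_setVsetC (x @^-1` B) UU.
by have [r [/= nBr Br]] := lx (~` B) B nB Bl.
Qed.

(** Bolzano-Weierstrass, coordinate by coordinate. Along an ultrafilter all
    the coordinates converge at once, so that no subsequence is extracted. *)
Lemma ultra_wcvg_bounded (U : set_system I) z M :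
  UltraFilter U -> (forall n, dot (z n) (z n) <= M) -> exists p, wcvg U z p.
Proof.
move=> UU zM; have [a [b ab]] := dual_basis H.
have az w : cvg (dot w (z n) @[n --> U]).
  apply: (@ultra_cvg_bounded _ _ (Num.sqrt (dot w w * M))) => n.
  rewrite -sqrtr_sqr ler_wsqrtr //; apply: le_trans (cauchy_schwarz _ _) _.
  by rewrite ler_wpM2l // dot_ge0.
exists (\sum_i lim (dot (a i) (z n) @[n --> U]) *: b i) => w.
rewrite dot_sumr; under eq_fun => n do rewrite (ab (z n)) dot_sumr.
apply: cvg_big => [|i _]; first exact: add_continuous.
by apply: cvgM; [apply: az | apply: cvg_cst].
Qed.

End Cvg.

(** * The partial inverse method *)

Section PartialInverse.
Variables (R : realType) (H : euclidType R) (f : H -> R) (W : {vspace H}).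
Variable eta : R.
Hypothesis eta_gt0 : 0 < eta.
Hypothesis cf : convexf f.
Local Notation P := (orth_proj W).

(** The fixed points of the iteration below. The condition on p is stated
    through the subgradient: it makes P p the proximal point of f at p. *)
Definition fixpt (p : H) := subgrad f (P p) (eta *: (p - P p)).

(** Spingarn's step z_(n+1) = P v_n + Q (z_n - v_n); the subgradient condition
    makes v_n the proximal point of f at z_n. *)
Definition partial_inverse (z v : nat -> H) := forall n,
  subgrad f (v n) (eta *: (z n - v n)) /\
  z n.+1 = P (v n) + (z n - P (z n)) - (v n - P (v n)).

Variables z v : nat -> H.
Hypothesis step : partial_inverse z v.

(** Monotonicity of the subgradient at v_n and at P p gives <e - d, d> >= 0,
    where e = z_n - p and d = v_n - P p. With e' = z_(n+1) - p one has
    <e - e', e'> = <e - d, d>, so that |e|^2 >= |e'|^2 + |e' - e|^2. *)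
Lemma fejer p n : fixpt p ->
  dot (z n.+1 - p) (z n.+1 - p) + dot (z n.+1 - z n) (z n.+1 - z n)
    <= dot (z n - p) (z n - p).
Proof.
move=> fp; have [sv zS] := step n.
set d := v n - P p; set e := z n - p.
have mono : 0 <= dot (e - d) d.
  have := lerD (sv (P p)) (fp (v n)); rewrite -(opprB (v n) (P p)) -/d => h.
  rewrite -(pmulr_rge0 _ eta_gt0) -dotZl.
  have -> : e - d = (z n - v n) - (p - P p) by rewrite /e /d !opprD addrACA.
  by rewrite dotNr in h; rewrite scalerBr dotDl dotNl; lra.
have dP : P d = P (v n) - P p by rewrite linearB /= orth_proj_idem.
have eP : P e = P (z n) - P p by rewrite linearB.
have zp : z n.+1 - p = P d + ((e - P e) - (d - P d)).
  by apply: dot_inj => w; rewrite zS dP eP /d /e !dot_linE; ring.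
have zz : z n.+1 - z n = z n.+1 - p - e by rewrite /e opprB addrA subrK.
rewrite zz zp; clearbody d e; move: mono.
rewrite !dot_linE !(dotC d (P _)) !(dotC e (P _)).
rewrite (dot_projl W d d) (dot_projl W d e) (dot_projl W e d) (dot_projl W e e).
rewrite (dotC (P e) (P d)) (dotC e d).
lra.
Qed.

Let s n := z n.+1 - z n.

(** Recovers v_n from the z_n, so that its convergence is that of z_n. *)
Lemma prox_point_of_steps n : v n = P (z n.+1) - s n + P (s n).
Proof.
have [_ zS] := step n.
have PzS : P (z n.+1) = P (v n).
  by rewrite zS linearB linearD !linearB /= !orth_proj_idem !subrr !addr0.
have Ps : P (s n) = P (v n) - P (z n) by rewrite /s linearB /= PzS.
by apply: dot_inj => w; rewrite PzS Ps /s zS !dot_linE; ring.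
Qed.

(** Opial's argument: the distances to a fixed point p0 are nonincreasing, which
    bounds z_n and makes its steps tend to 0; a limit point p is then a fixed
    point itself, and the nonincreasing distance to p must tend to 0. *)
Lemma partial_inverse_cvg p0 : fixpt p0 -> exists p,
  [/\ fixpt p, wcvg \oo z p & wcvg \oo v (P p)].
Proof.
move=> fp0.
pose a p n := dot (z n - p) (z n - p).
have a_cvg p : fixpt p -> cvg (a p n @[n --> \oo]).
  move=> fp; apply: nonincreasing_is_cvgn.
    apply/nonincreasing_seqP => n; apply: le_trans (fejer n fp).
    by rewrite lerDl dot_ge0.
  by exists 0 => _ [n _ <-]; apply: dot_ge0.
have s0 : wcvg \oo s 0.
  apply: wcvg_dot0; have /cvg_ex[l al] := a_cvg _ fp0.
  have aS : a p0 n - a p0 n.+1 @[n --> \oo] --> 0.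
    by rewrite -(subrr l); apply: cvgB => //; rewrite cvg_shiftS.
  apply: squeeze_cvgr (cvg_cst 0) aS; near=> n.
  by rewrite subr0 dot_ge0 lerBrDl fejer.
have [U [UU ooU]] := ultraFilterLemma (F := \oo) _.
have [p zUp] : exists p, wcvg U z p.
  have [|p zp] := @ultra_wcvg_bounded _ _ _ U (fun n => z n - p0) (a p0 0%N) UU.
    elim=> // n; apply: le_trans; apply: le_trans (fejer n fp0).
    by rewrite lerDl dot_ge0.
  exists (p + p0); rewrite (_ : z = fun n => z n - p0 + p0).
    exact: wcvgD zp (@wcvg_cst _ _ _ U _ p0).
  by apply/funext => n; rewrite subrK.
have sU : wcvg U s 0 by move=> w; apply: cvg_trans (s0 w); apply: cvg_app.
have v_cvg F : Filter F -> wcvg F s 0 -> wcvg F z p -> wcvg F v (P p).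
  move=> FF s0F zF; have -> : v = fun n => P (z n + s n) - s n + P (s n).
    by apply/funext => n; rewrite prox_point_of_steps [z n + _]addrC subrK.
  have -> : P p = P (p + 0) - 0 + P 0 by rewrite !linear0 !addr0.
  apply: wcvgD; last exact: wcvg_proj.
  by apply: wcvgB => //; apply: wcvg_proj; apply: wcvgD.
have vUp : wcvg U v (P p) by apply: v_cvg.
have fp : fixpt p.
  move=> x; have [y yf] := subgrad_exists (P p) cf.
  (* The subgradient y of f at P p bounds f (v n) from below by a convergent
     sequence: this is the lower semicontinuity of f at P p. *)
  pose lb n := f (P p) + dot y (v n - P p) + eta * dot (z n - v n) (x - v n).
  have lbx n : lb n <= f x.
    have [sv _] := step n; apply: le_trans (sv x).
    by rewrite dotZl lerD2r yf.
  rewrite dotZl -[X in X + _]addr0 -[X in _ + X + _](dot0r y) -(subrr (P p)).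
  suff lb_cvg : lb n @[n --> U] -->
      f (P p) + dot y (P p - P p) + eta * dot (p - P p) (x - P p).
    by apply: cvgr_to_le lb_cvg _; apply: nearW => n; apply: lbx.
  apply: cvgD; last first.
    apply: cvgM (cvg_cst _) _; apply: wcvg_dot.
      exact: wcvgB zUp vUp.
    exact: wcvgB (@wcvg_cst _ _ _ U _ x) vUp.
  apply: cvgD (cvg_cst _) _.
  by apply: (wcvgB vUp (@wcvg_cst _ _ _ U _ (P p))).
have zp : wcvg \oo z p.
  apply: wcvg_dot0; have /cvg_ex[l al] := a_cvg _ fp.
  suff l0 : l = 0 by rewrite -l0.
  have aU : a p n @[n --> U] --> l by apply: cvg_trans al; apply: cvg_app.
  apply: (cvg_unique _ aU) => //; rewrite -(dot0l (0 : H)) -(subrr p).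
  by apply: wcvg_dot; apply: wcvgB => //; apply: wcvg_cst.
by exists p; split => //; apply: v_cvg.
Unshelve. all: by end_near. Qed.

End PartialInverse.

(** * Direct sums and the decoupled method *)

Section DirectSum.
Variables (R : realType) (I : finType) (H : euclidType R).
Variable U : I -> {vspace H}.
Implicit Types v w : dsum U.

Lemma dot_dsum v w : dot v w = \sum_i dot (dsum_comp i v) (dsum_comp i w).
Proof. by apply: eq_bigr => i _; rewrite -!dsum_compE. Qed.

Lemma dsum_compD i v w : dsum_comp i (v + w) = dsum_comp i v + dsum_comp i w.
Proof. by apply: val_inj; rewrite linearD /= !dsum_compE linearD ffunE. Qed.

Lemma dsum_compZ i a v : dsum_comp i (a *: v) = a *: dsum_comp i v.
Proof. by apply: val_inj; rewrite linearZ /= !dsum_compE linearZ ffunE. Qed.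

Lemma dsum_compB i v w : dsum_comp i (v - w) = dsum_comp i v - dsum_comp i w.
Proof. by rewrite -scaleN1r dsum_compD dsum_compZ scaleN1r. Qed.

Lemma dual_comp_riesz (l : 'Hom(dsum U, R^o)) i :
  riesz_inv _ (dual_comp l i) = dsum_comp i (riesz_inv _ l).
Proof.
apply: dot_inj => w; rewrite riesz_invE comp_lfunE -riesz_invE dot_dsum.
rewrite (bigD1 i) //= big1 ?addr0 => [|j ji].
  by congr dot; apply: val_inj; rewrite /= dsum_compE dsum_injE eqxx.
rewrite [X in dot _ X](_ : _ = 0) ?dot0r //; apply: val_inj.
by rewrite /= dsum_compE dsum_injE (negbTE ji).
Qed.

End DirectSum.

Section Method.
Variables (R : realType) (M N K : nat).
Variable T : imageV R (pixel M N) -> imageV R (pixel M N).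
Variable Om : 'I_K -> {set pixel M N}.
Variables (eta : R) (eta_gt0 : 0 < eta).
Local Notation W := (lker (jump T Om)).
Local Notation P := (orth_proj W).
Implicit Types (u w : tVsum T Om) (l : 'Hom(tVsum T Om, R^o)).

Lemma PBcE w : PBc T Om w = w - P w.
Proof. by rewrite add_lfunE opp_lfunE id_lfunE. Qed.

(** The local problems decouple one proximal problem on the direct sum: its
    objective is the sum of the local objectives, and a point of the direct sum
    is a free choice of components. *)
Lemma prox_of_local_argmin u w l :
  (forall s, argmin
     (fun x : tV T Om s => localE T Om s (vsval x)
        + eta / 2 * enorm (x - hatu eta u l s) ^+ 2) (dsum_comp s w)) ->
  let c := P u - eta^-1 *: riesz_inv _ l in
  forall w', tE w + eta / 2 * dot (w - c) (w - c)
          <= tE w' + eta / 2 * dot (w' - c) (w' - c).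
Proof.
move=> wmin c w'.
have hatuE s : hatu eta u l s = dsum_comp s c.
  by rewrite /c dsum_compB dsum_compZ -dual_comp_riesz.
have objE x : tE x + eta / 2 * dot (x - c) (x - c) =
    \sum_s (localE T Om s (vsval (dsum_comp s x))
            + eta / 2 * enorm (dsum_comp s x - hatu eta u l s) ^+ 2).
  rewrite big_split /= -mulr_sumr dot_dsum; congr (_ + _ * _).
  by apply: eq_bigr => s _; rewrite enorm_sqr hatuE dsum_compB.
by rewrite !objE; apply: ler_sum => s _; apply: wmin.
Qed.

(** With multiplier - eta Q p, the subgradient inequality of a fixed point says
    that P p minimizes f + <Q w, lambda> over w; the quadratic penalty only
    increases the Lagrangian elsewhere and vanishes at P p. *)
Lemma critical_of_fixpoint p : fixpt (@tE R M N K T Om) W eta p ->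
  critical_point eta (P p) (riesz _ (- eta *: (p - P p))).
Proof.
move=> fp; have PcP : PBc T Om (P p) = 0 by rewrite PBcE orth_proj_idem subrr.
split=> // w.
have dualE x : dot (riesz _ (PBc T Om x)) (riesz _ (- eta *: (p - P p)))
    = dot (PBc T Om x) (- eta *: (p - P p)).
  by rewrite /dot /= /ddot !rieszK.
rewrite /lagrangian !dualE !enorm_sqr PcP !dot0l mulr0 !addr0.
have := fp w.
have pen : 0 <= eta / 2 * dot (PBc T Om w) (PBc T Om w).
  by rewrite mulr_ge0 ?dot_ge0 // divr_ge0 // ltW.
move: pen; rewrite {3}PBcE !(dotBl, dotNr, dotZr, dotZl, dotDr).
rewrite (dotC w p) (dotC w (P p)) (dotC p (P p)) (dotC (P w) p).
rewrite (dotC (P w) (P p)).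
rewrite -(dot_proj W p w) (dot_projl W p p) (dot_projl W p w).
lra.
Qed.

End Method.

Theorem theorem3p4 (R : realType) (M N K : nat)
    (T : imageV R (pixel M N) -> imageV R (pixel M N))
    (Om : 'I_K -> {set pixel M N})
    (Om_partition : rectangular_partition Om)
    (Om_ed : forall s, Om s \subset tOm T Om s)
    (eta : R) (eta_gt0 : 0 < eta)
    (tE_convex : convex_function [set: convex_lmodType (tVsum T Om)]
                   (@tE R M N K T Om))
    (min_attained : exists2 u0 : tVsum T Om, u0 \in lker (jump T Om) &
       forall v : tVsum T Om, v \in lker (jump T Om) -> tE u0 <= tE v)
    (u : nat -> tVsum T Om) (l : nat -> 'Hom(tVsum T Om, R^o))
    (run : dalm eta u l) :
  exists (u' : tVsum T Om) (l' : 'Hom(tVsum T Om, R^o)),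
    [/\ critical_point eta u' l',
        enorm (u n - u') @[n --> \oo] --> (0 : R)
      & enorm (l n - l') @[n --> \oo] --> (0 : R)].
Proof.
have cE := convex_function_convexf tE_convex.
set W := lker (jump T Om) in min_attained.
pose P := orth_proj W.
pose m n := riesz_inv _ (l n).
have [m0W step] := run.
have mS n : m n.+1 = m n + eta *: (u n.+1 - P (u n.+1)).
  have [_ lS] := step n.
  by rewrite /m lS linearD linearZ /= rieszK PBcE.
have mW n : m n \in orthv W.
  elim: n => // n mnW; rewrite mS memvD ?memvZ //.
  by case: (orth_projP W (u n.+1)).
pose z n := P (u n) - eta^-1 *: m n.
have Pz n : P (z n) = P (u n).
  rewrite /z linearB linearZ /= orth_proj_idem (orth_proj_orth (mW n)).
  by rewrite scaler0 subr0.
have mE n : m n = - eta *: (z n - P (z n)).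
  rewrite Pz /z addrAC subrr add0r scalerN scaleNr opprK scalerA.
  by rewrite mulfV ?scale1r // gt_eqF.
have z_step : partial_inverse (@tE R M N K T Om) W eta z (fun n => u n.+1).
  move=> n; have [umin _] := step n.
  split; first exact: prox_subgrad cE (prox_of_local_argmin umin).
  rewrite Pz /z mS scalerDr scalerA mulVf ?scale1r; last by rewrite gt_eqF.
  by apply: dot_inj => w; rewrite !dot_linE; ring.
have [u0 u0W u0min] := min_attained.
have [y yW yE] := constrained_min_subgrad cE u0W u0min.
pose p0 := u0 + eta^-1 *: y.
(* A constrained minimizer shifted by its multiplier is a fixed point. *)
have p0_fix : fixpt (@tE R M N K T Om) W eta p0.
  have Pp0 : P p0 = u0.
    rewrite /p0 linearD linearZ /= (orth_proj_id u0W) (orth_proj_orth yW).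
    by rewrite scaler0 addr0.
  rewrite /fixpt -/P Pp0 /p0 addrC addKr scalerA mulfV ?scale1r //.
  by rewrite gt_eqF.
have [p [fp zp up]] := partial_inverse_cvg eta_gt0 cE z_step p0_fix.
exists (P p), (riesz _ (- eta *: (p - P p))); split.
- exact: critical_of_fixpoint.
- by rewrite -(cvg_shiftS (fun n => enorm (u n - P p))); apply: wcvg_enorm up.
have -> : (fun n => enorm (l n - riesz _ (- eta *: (p - P p)))) =
          fun n => enorm (- eta *: (z n - P (z n)) - - eta *: (p - P p)).
  by apply/funext => n; rewrite -mE /enorm /dot /= /ddot linearB /= rieszK.
apply: wcvg_enorm; apply: wcvgZ; apply: wcvgB => //.
exact: wcvg_proj.
Qed.
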